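(* For every integer $n \ge 1$, let $P(n)$ be the number of unordered three-heap P-positions in Nim with $n$ counters in total and all heaps non-empty, i.e. the number of multisets $\{a,b,c\}$ of positive integers with $a+b+c=n$ whose bitwise XOR $a \oplus b \oplus c$ is $0$. Then $P(n) \equiv m(n) \pmod 2$.
   Context: For a non-negative integer $k$, $s_2(k)$ denotes the number of ones in the binary expansion of $k$. Define $\bar{t}(k) = 1$ if $s_2(k)$ is even and $\bar{t}(k)=0$ if $s_2(k)$ is odd. The sequence $m(n)$, $n \ge 0$, is defined by $m(2k) = \bar{t}(k)$ and $m(2k+1) = 0$ for all $k \ge 0$. The sequence $P(n)$ is OEIS A128975, indexed from $n=1$: $0,0,0,0,0,1,0,0,0,1,0,1,0,4,\ldots$. *)

(* Defs.v *)
From mathcomp Require Import all_boot.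
From Stdlib Require Import PeanoNat.

Set Implicit Arguments.
Unset Strict Implicit.
Unset Printing Implicit Defensive.

(* Since k < 2 ^ k, every binary digit of k at a position i >= k is zero. *)
Definition s2 (k : nat) : nat := \sum_(i < k) Nat.testbit k i.

Definition tbar (k : nat) : nat := if odd (s2 k) then 0 else 1.

Definition m (n : nat) : nat := if odd n then 0 else tbar n./2.

(* A heap of a position with n counters has at most n counters, so heaps can
   be taken in the finite type 'I_n.+1. *)
Definition nim_Ppositions (n : nat) : {set 3.-tuple 'I_n.+1} :=
  [set t : 3.-tuple 'I_n.+1 |
    [&& all (fun a : 'I_n.+1 => 0 < a) t,
        \sum_(a <- t) a == n
      & \big[Nat.lxor/0]_(a <- t) a == 0]].

(* A multiset of three heaps is a class of triples up to reordering; all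
   reorderings of a triple in nim_Ppositions n are in nim_Ppositions n. *)
Definition P (n : nat) : nat :=
  #|equivalence_partition (fun t u : 3.-tuple 'I_n.+1 => perm_eq t u)
                          (nim_Ppositions n)|.

(* Main.v *)
From HB Require Import structures.
From Stdlib Require Import PeanoNat.
Require Import Defs.
From mathcomp Require Import all_boot.
From mathcomp Require Import zify.

(** Three heaps [a], [b], [a xor b] contain [2 (a or b)] counters, so an odd
    [n] admits no position, and for [n = 2k] the ordered positions, empty heaps
    allowed, are the pairs [(a, b)] with [a or b = k].  Choosing the bits of [a]
    and [b] independently gives [3 ^ s2 k] pairs.  For [k > 0] exactly three of
    them have an empty heap, and the heaps of the others are pairwise distinct,
    whence [3 ^ s2 k = 3 + 6 P (2k)].  Reducing [3 ^ (s2 k - 1) = 1 + 2 P (2k)]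
    modulo 4 gives the parity of [P (2k)]. *)

Lemma Nat_oddE n : Nat.odd n = odd n.
Proof.
by elim: n => // n IHn; rewrite Nat.odd_succ -Nat.negb_odd IHn.
Qed.

Lemma Nat_testbit0 n : Nat.testbit n 0 = odd n.
Proof. by rewrite Nat.bit0_odd Nat_oddE. Qed.

Lemma Nat_testbitS n i : Nat.testbit n i.+1 = Nat.testbit n./2 i.
Proof.
rewrite -Nat.testbit_div2; congr Nat.testbit.
by elim/ltn_ind: n => -[|[|n]] //= IHn; rewrite IHn.
Qed.

Lemma odd_lor a b : odd (Nat.lor a b) = odd a || odd b.
Proof. by rewrite -!Nat_testbit0 Nat.lor_spec. Qed.

Lemma odd_lxor a b : odd (Nat.lxor a b) = odd a (+) odd b.
Proof. by rewrite -!Nat_testbit0 Nat.lxor_spec; do 2!case: Nat.testbit. Qed.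

Lemma half_lor a b : (Nat.lor a b)./2 = Nat.lor a./2 b./2.
Proof.
apply: Nat.bits_inj => i.
by rewrite -Nat_testbitS !Nat.lor_spec !Nat_testbitS.
Qed.

Lemma half_lxor a b : (Nat.lxor a b)./2 = Nat.lxor a./2 b./2.
Proof.
apply: Nat.bits_inj => i.
by rewrite -Nat_testbitS !Nat.lxor_spec !Nat_testbitS.
Qed.

Lemma odd_half_inj m n : odd m = odd n -> m./2 = n./2 -> m = n.
Proof.
by move=> eq_odd eq_half; rewrite -[m]odd_double_half eq_odd eq_half odd_double_half.
Qed.

(** On single bits, [x + y + (x xor y)] is twice [x or y]; weighting by powers of 2 gives the
    identity. The induction peels off the lowest bit. *)
Lemma add_lxorE a b : a + b + Nat.lxor a b = (Nat.lor a b).*2.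
Proof.
elim/ltn_ind: a b => -[|a] IHa b.
  by rewrite Nat.lxor_0_l Nat.lor_0_l addnn.
have /IHa/(_ b./2) : (a.+1)./2 < a.+1 by lia.
rewrite -half_lxor -half_lor; move: (odd_lxor a.+1 b) (odd_lor a.+1 b).
move: (Nat.lxor _ _) (Nat.lor _ _) => x o; lia.
Qed.

(** The range of the sum in [s2 k] depends on [k]; a free bound makes sums for different numbers
    comparable. *)
Lemma sum_testbit_widen k n :
  k <= n -> \sum_(i < n) Nat.testbit k i = s2 k.
Proof.
have testbit0 i j : i <= j -> Nat.testbit i j = false.
  elim: j i => [|j IHj] i; first by rewrite leqn0 => /eqP->.
  by move=> le_ij; rewrite Nat_testbitS IHj //; lia.
move=> le_kn; rewrite /s2 -!(big_mkord xpredT (fun i => Nat.testbit k i : nat)).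
rewrite (big_cat_nat (leq0n k) le_kn) //= [X in _ + X]big_nat_cond.
by rewrite [X in _ + X]big1 ?addn0 // => i; rewrite andbT => /andP[/testbit0->].
Qed.

Lemma s2E k : s2 k = odd k + s2 k./2.
Proof.
(* With [k.+1] digits, splitting off digit 0 leaves [k] of them, enough for [k./2]. *)
rewrite -(@sum_testbit_widen k k.+1) // big_ord_recl Nat_testbit0.
rewrite -(@sum_testbit_widen k./2 k); last lia.
by congr (_ + _); apply: eq_bigr => i _; rewrite -Nat_testbitS.
Qed.

(** The pairs live in the infinite type [nat * nat], so they are counted by a duplicate-free list,
    built digit by digit. *)
Lemma lor_pairs k : exists2 l : seq (nat * nat), uniq l /\ size l = 3 ^ s2 k
  & forall a b, ((a, b) \in l) = (Nat.lor a b == k).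
Proof.
elim/ltn_ind: k => -[|k] IHk.
  exists [:: (0, 0)]; first by rewrite /s2 big_ord0.
  move=> a b; rewrite inE; apply/eqP/eqP => [[-> ->] //|].
  by case/Nat.lor_eq_0_iff=> -> ->.
have /IHk[l [uniq_l size_l] mem_l] : (k.+1)./2 < k.+1 by lia.
(* [ext e] appends the bits [e] as new lowest digits of the two numbers. *)
pose ext (e : bool * bool) (p : nat * nat) := (e.1 + p.1.*2, e.2 + p.2.*2).
have ext_inj e : injective (ext e).
  by case: e => ea eb [a b] [a' b']; rewrite /ext /= => -[] ? ?; congr pair; lia.
have mem_ext e a b : ((a, b) \in map (ext e) l) =
    [&& odd a == e.1, odd b == e.2 & Nat.lor a./2 b./2 == (k.+1)./2].
  case: e => ea eb; rewrite -mem_l /=; apply/mapP/and3P => [[[a' b'] l_ab [-> ->]]|].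
    rewrite /= !oddD !odd_double !oddb !addbF !eqxx; split=> //.
    by rewrite !half_bit_double.
  case=> /eqP <- /eqP <- l_ab; exists (a./2, b./2) => //.
  by rewrite /ext /= !odd_double_half.
have lorE a b : (Nat.lor a b == k.+1) =
    ((odd a || odd b) == odd k.+1) && (Nat.lor a./2 b./2 == (k.+1)./2).
  apply/eqP/andP => [<-|[/eqP eq_odd /eqP eq_half]].
    by rewrite odd_lor half_lor !eqxx.
  by apply: odd_half_inj; rewrite ?odd_lor ?half_lor.
(* A lowest digit 0 forces both bits to be 0; a digit 1 allows three pairs of bits, whose lists are
   disjoint by parity. *)
case odd_k: (odd k.+1); last first.
  exists (map (ext (false, false)) l).
    by rewrite map_inj_uniq // size_map size_l [s2 k.+1]s2E odd_k.
  by move=> a b; rewrite mem_ext lorE odd_k; case: (odd a) (odd b) => -[].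
exists (map (ext (true, true)) l ++
        map (ext (true, false)) l ++ map (ext (false, true)) l).
  split; last first.
    by rewrite !size_cat !size_map size_l [s2 k.+1]s2E odd_k add1n expnS; lia.
  rewrite !cat_uniq !map_inj_uniq // uniq_l /= !andbT -!all_predC.
  apply/andP; split; apply/allP => -[a b]; rewrite ?mem_cat /= !mem_ext /=;
  by case: (odd a); case: (odd b); rewrite ?andbF.
move=> a b; rewrite !mem_cat !mem_ext lorE odd_k.
by case: (odd a); case: (odd b) => //=; rewrite ?orbF.
Qed.

(** The xor condition determines the third heap, which is non-empty exactly when the first two
    differ; [add_lxorE] gives the total. *)
Lemma nim_PpositionsP n (t : 3.-tuple 'I_n.+1) :
  reflect (exists a b : 'I_n.+1, exists2 c : 'I_n.+1, t = [tuple a; b; c]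
            & [/\ 0 < a, 0 < b, a != b, c = Nat.lxor a b :> nat
              & n = (Nat.lor a b).*2])
          (t \in nim_Ppositions n).
Proof.
rewrite inE; apply: (iffP and3P) => [[]|[a] [b] [c] -> [a0 b0 ab cE nE]].
  case/tupleP: t => a t; case/tupleP: t => b t; case/tupleP: t => c t.
  rewrite (tuple0 t) /= !big_cons !big_nil Nat.lxor_0_r addn0 andbT.
  case/and3P=> a0 b0 c0 /eqP sum_n /eqP.
  rewrite -Nat.lxor_assoc => /Nat.lxor_eq_0_iff cE.
  exists a, b, c; first exact/val_inj.
  split=> //.
    by apply: contraTneq c0 => ab; rewrite -cE ab Nat.lxor_nilpotent.
  by rewrite -add_lxorE cE -addnA.
rewrite /= !big_cons !big_nil Nat.lxor_0_r addn0 andbT a0 b0 addnA cE add_lxorE.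
rewrite -nE -Nat.lxor_assoc Nat.lxor_nilpotent; split=> //=.
rewrite lt0n; apply: contra ab => /eqP/Nat.lxor_eq_0_iff ab.
exact/eqP/val_inj.
Qed.

Lemma card_nim_Ppositions k :
  0 < k -> 3 ^ s2 k = 3 + #|nim_Ppositions k.*2|.
Proof.
move=> k_gt0; have [l [uniq_l <-] mem_l] := lor_pairs k.
(* [f] forgets the third heap; it is injective on positions, where that heap is the xor of the
   others. *)
pose f (t : 3.-tuple 'I_k.*2.+1) := (tnth t ord0 : nat, tnth t (inord 1) : nat).
have fE a b c : f [tuple a; b; c] = (a : nat, b : nat).
  by rewrite /f !(tnth_nth a) /= inordK.
have mem_f a b : reflect [/\ 0 < a, 0 < b, a != b & Nat.lor a b = k]
    ((a, b) \in map f (enum (nim_Ppositions k.*2))).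
  apply: (iffP mapP) => [[t]|[a0 b0 ab lor_k]].
    rewrite mem_enum => /nim_PpositionsP[a'] [b'] [c] -> [a0 b0 ab _ kE].
    by rewrite fE => -[-> ->]; split=> //; lia.
  (* All three heaps are at most [k.*2], so [inord] keeps their values. *)
  have := add_lxorE a b; rewrite lor_k => sum_k.
  exists [tuple inord a; inord b; inord (Nat.lxor a b)].
    rewrite mem_enum; apply/nim_PpositionsP.
    exists (inord a), (inord b), (inord (Nat.lxor a b)) => //.
    by rewrite -val_eqE /= !inordK ?lor_k //; lia.
  by rewrite fE !inordK //; lia.
(* The three extra pairs are those with [a = 0], [b = 0] or [a = b]; they are distinct because
   [k > 0]. *)
rewrite cardE -(size_map f) -[RHS]/(size ([:: (0, k); (k, 0); (k, k)] ++ _)).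
apply/perm_size/uniq_perm => //.
  rewrite cat_uniq; apply/and3P; split.
  - by rewrite /= !inE !xpair_eqE; lia.
  - rewrite -all_predC; apply/allP => -[a b] /mem_f[a0 b0 ab _] /=.
    by rewrite !inE !xpair_eqE; lia.
  rewrite map_inj_in_uniq ?enum_uniq // => t u; rewrite !mem_enum.
  case/nim_PpositionsP=> a [b] [c] -> [_ _ _ cE _].
  case/nim_PpositionsP=> a' [b'] [c'] -> [_ _ _ cE' _].
  rewrite !fE => -[/val_inj eq_a /val_inj eq_b]; rewrite eq_a eq_b in cE *.
  by congr [tuple _; _; _]; apply: val_inj; rewrite /= cE cE'.
case=> a b; rewrite mem_l mem_cat; apply/eqP/orP => [lor_k|[|/mem_f[]//]].
  have [a0|a0] := posnP a.
    by left; rewrite -lor_k a0 Nat.lor_0_l !inE eqxx.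
  have [b0|b0] := posnP b.
    by left; rewrite -lor_k b0 Nat.lor_0_r !inE eqxx !orbT.
  have [ab|ab] := eqVneq a b.
    by left; rewrite -lor_k ab Nat.lor_diag !inE eqxx !orbT.
  by right; apply/mem_f.
rewrite !inE => /or3P[] /eqP[-> ->].
- exact: Nat.lor_0_l.
- exact: Nat.lor_0_r.
- exact: Nat.lor_diag.
Qed.

Lemma card_perm_eq_tuple (T : finType) n (t : n.-tuple T) :
  uniq t -> #|[set u : n.-tuple T | perm_eq t u]| = n`!.
Proof.
move=> uniq_t; have := size_permutations uniq_t; rewrite size_tuple => <-.
rewrite cardE -(size_map val); apply/perm_size/uniq_perm.
- by rewrite map_inj_uniq ?enum_uniq //; apply: val_inj.
- exact: permutations_uniq.
move=> s; rewrite mem_permutations; apply/mapP/idP => [[u]|perm_st].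
  by rewrite mem_enum inE perm_sym => + ->.
have size_s : size s == n by rewrite (perm_size perm_st) size_tuple.
by exists (Tuple size_s); rewrite // mem_enum inE perm_sym.
Qed.

(** Allows [perm_big] to reorder the xor of the heaps. *)
HB.instance Definition _ := Monoid.isComLaw.Build nat 0 Nat.lxor
  (fun x y z => esym (Nat.lxor_assoc x y z)) Nat.lxor_comm Nat.lxor_0_l.

(** The heaps of a position are pairwise distinct, so each class has [3! = 6] triples. *)
Lemma card_nim_Ppositions_perm n : #|nim_Ppositions n| = P n * 6.
Proof.
apply: card_uniform_partition; last first.
  apply: equivalence_partitionP => t u v _ _ _ /=; split=> // /permPl eq_tu.
  exact: eq_tu.
move=> _ /imsetP[t t_pos ->].
rewrite -[6]/(3`!) -(@card_perm_eq_tuple _ _ t).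
  (* The conditions on a position are symmetric, so its class contains all its reorderings. *)
  apply: eq_card => u; rewrite !inE andb_idl // => perm_tu.
  move: t_pos; rewrite inE => /and3P[t_gt0 t_sum t_xor].
  rewrite -(perm_all _ perm_tu) t_gt0 -(perm_big _ perm_tu) t_sum /=.
  by rewrite -(perm_big _ perm_tu).
have /nim_PpositionsP[a [b [c -> [a0 b0 ab cE _]]]] := t_pos.
rewrite /= !inE negb_or ab /= andbT -!val_eqE /= cE.
(* If [a] or [b] equalled [a xor b], cancelling it would make the other one 0. *)
apply/andP; split; apply/eqP => eq_x.
  have := Nat.lxor_assoc a a b; rewrite -eq_x Nat.lxor_nilpotent Nat.lxor_0_l.
  by move=> b_eq0; rewrite b_eq0 in b0.
have := Nat.lxor_assoc a b b; rewrite -eq_x Nat.lxor_nilpotent Nat.lxor_0_r.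
by move=> a_eq0; rewrite -a_eq0 in a0.
Qed.

Theorem lemma2 (n : nat) (hn : 1 <= n) : P n = m n %[mod 2].
Proof.
have card6 := card_nim_Ppositions_perm n.
rewrite /m; case: ifPn => [odd_n|even_n].
  suff : #|nim_Ppositions n| = 0 by move=> card0; congr (_ %% 2); lia.
  apply/eqP; rewrite cards_eq0; apply/set0Pn => -[t].
  by case/nim_PpositionsP=> ? [?] [?] _ [_ _ _ _ nE]; rewrite nE odd_double in odd_n.
have nE : n = n./2.*2 by lia.
have k_gt0 : 0 < n./2 by lia.
have := card_nim_Ppositions _ k_gt0; rewrite -nE card6 /tbar.
(* A zero digit sum would give [1 = 3 + 6 P], which is absurd. *)
case: (s2 _) => [|r]; first lia.
(* Since 3 is -1 modulo 4, [3 ^ r = 1 + 2 P] makes [P] odd exactly for odd [r], that is, for even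
   digit sum [r.+1]. *)
have : 3 ^ r %% 4 = if odd r then 3 else 1.
  by elim: r => //= r IHr; rewrite expnS -modnMmr IHr; case: odd.
rewrite expnS /=; case: (odd r) => /=; lia.
Qed.
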